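(* Consider the two-dimensional Ripa model with conservative variables $\boldsymbol U=(h,hu,hv,h\theta)^T$ and equilibrium variables $\boldsymbol V=(h,u,v,p)^T$, $p=\frac12gh^2\theta$. The semi-discrete discontinuous Galerkin method: find $\boldsymbol V\in\boldsymbol{\mathcal V}_h^k$ such that for every cell $\mathcal T\in\mathcal K$ and every $\boldsymbol\varphi\in\boldsymbol{\mathcal V}_h^k$ $$\frac{d}{dt}\int_{\mathcal T}\boldsymbol U(\boldsymbol V)\cdot\boldsymbol\varphi\,d\boldsymbol x=\mathrm{RHS}^{\mathrm{iso}}(\boldsymbol V,b,\boldsymbol\varphi),$$ $$\mathrm{RHS}^{\mathrm{iso}}(\boldsymbol V,b,\boldsymbol\varphi)=\int_{\mathcal T}\boldsymbol F(\boldsymbol U(\boldsymbol V)):\nabla\boldsymbol\varphi\,d\boldsymbol x-\int_{\partial\mathcal T}\widehat{\boldsymbol F}^{\mathrm{mod}}\cdot\boldsymbol\varphi^{int_{\mathcal T}}\,ds+\int_{\mathcal T}\boldsymbol r(\boldsymbol U(\boldsymbol V),b)\cdot\boldsymbol\varphi\,d\boldsymbol x,$$ with the modified flux $$\widehat{\boldsymbol F}^{\mathrm{mod}}=\tfrac12\left(\boldsymbol F(\boldsymbol U^{int_{\mathcal T}})\cdot\boldsymbol n+\boldsymbol F(\boldsymbol U^{ext_{\mathcal T}})\cdot\boldsymbol n-\alpha\delta(\boldsymbol U^{ext_{\mathcal T}}-\boldsymbol U^{int_{\mathcal T}})\right),$$ $$\delta=\max\left(\frac{-\min(\boldsymbol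 u^{int_{\mathcal T}}\cdot\boldsymbol n,0)}{\max(|\boldsymbol u^{int_{\mathcal T}}\cdot\boldsymbol n|,1)},\ \frac{\max(\boldsymbol u^{ext_{\mathcal T}}\cdot\boldsymbol n,0)}{\max(|\boldsymbol u^{ext_{\mathcal T}}\cdot\boldsymbol n|,1)}\right),\qquad \boldsymbol u=(u,v),$$ is exact for the isobaric equilibrium state $u=0$, $v=0$, $b=\text{constant}$, $h^2\theta=\text{constant}$. That is: if $b$ is constant and $\boldsymbol V=(h,u,v,p)^T\in\boldsymbol{\mathcal V}_h^k$ satisfies $u\equiv v\equiv0$ and $p\equiv c$ for a constant $c$ (with $h>0$), then $\mathrm{RHS}^{\mathrm{iso}}(\boldsymbol V,b,\boldsymbol\varphi)=0$ for every $\mathcal T\in\mathcal K$ and every $\boldsymbol\varphi\in\boldsymbol{\mathcal V}_h^k$.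
   Context: **Ripa model.** $h_t+(hu)_x+(hv)_y=0$, $(hu)_t+(hu^2+\frac12gh^2\theta)_x+(huv)_y=-gh\theta b_x$, $(hv)_t+(huv)_x+(hv^2+\frac12gh^2\theta)_y=-gh\theta b_y$, $(h\theta)_t+(hu\theta)_x+(hv\theta)_y=0$, written as $\boldsymbol U_t+\nabla\cdot\boldsymbol F(\boldsymbol U)=\boldsymbol r(\boldsymbol U,b)$, with $h>0$ the water height, $(u,v)$ the velocity, $\theta>0$ the temperature, $g>0$ constant, $b=b(x,y)$ the bottom topography. The variable transformation is $\boldsymbol V(\boldsymbol U)=(h,\frac{hu}{h},\frac{hv}{h},\frac g2h\cdot h\theta)^T$ with inverse $\boldsymbol U(\boldsymbol V)=(h,h\cdot u,h\cdot v,\frac2g\frac ph)^T$. **Mesh and spaces.** $\mathcal K$ is a partition of $\Omega\subset\mathbb R^2$ into axis-parallel rectangular cells $\mathcal T$; $k\ge0$; $\mathcal W_h^k=\{w: w|_{\mathcal T}\in P^k(\mathcal T)\ \forall\mathcal T\in\mathcal K\}$, where $P^k(\mathcal T)$ is the space of polynomials of degree at most $k$; $\boldsymbol{\mathcal V}_h^k=(\mathcal W_h^k)^4$. $\boldsymbol n$ is the outward unit normal on $\partial\mathcal T$. For $\boldsymbol x\in\partial\mathcal T$, $w^{int_{\mathcal T}}(\boldsymbol x)=\lim_{\epsilon\to0^+}w(\boldsymbol x-\epsilon\boldsymbol n)$ and $w^{ext_{\mathcal T}}(\boldsymbol x)=\lim_{\epsilon\to0^+}w(\boldsymbol x+\epsilon\boldsymbol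 n)$; $\boldsymbol U^{int_{\mathcal T}}=\boldsymbol U(\boldsymbol V^{int_{\mathcal T}})$ and $\boldsymbol U^{ext_{\mathcal T}}=\boldsymbol U(\boldsymbol V^{ext_{\mathcal T}})$. ''$\cdot$'' is the Euclidean product and ''$:$'' the Frobenius product. $\alpha\ge0$ is the (finite) global maximum of the absolute values of the eigenvalues of $\frac{\partial\boldsymbol F}{\partial\boldsymbol U}\cdot\boldsymbol n$. All integrals are exact. The height $h$ is positive on each closed cell, and may be discontinuous across cells. At $\partial\Omega$ the exterior traces are taken from an isobaric equilibrium state with zero velocity and the same pressure $c$. *)

(* Defs.v *)
From HB Require Import structures.
From mathcomp Require Import all_boot all_order all_algebra.
From mathcomp Require Import all_classical all_reals all_analysis.
From mathcomp Require Import -(notations) mpoly.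

Set Implicit Arguments.
Unset Strict Implicit.
Unset Printing Implicit Defensive.

Import Order.TTheory GRing.Theory Num.Theory.
Import numFieldNormedType.Exports.

Local Open Scope classical_set_scope.
Local Open Scope ring_scope.

(* Points and normals of the plane are pairs [R * R]; states are row vectors,
   [(h, hu, hv, h theta)] for U and [(h, u, v, p)] for V. *)

Definition c0 : 'I_4 := @Ordinal 4 0 isT.
Definition c1 : 'I_4 := @Ordinal 4 1 isT.
Definition c2 : 'I_4 := @Ordinal 4 2 isT.
Definition c3 : 'I_4 := @Ordinal 4 3 isT.

Section Ripa.
Context {R : realType}.
Implicit Types (U W : 'rV[R]_4) (n x : R * R).

Definition height W : R := W 0 c0.
Definition velocity W : R * R := (W 0 c1, W 0 c2).
Definition pressure W : R := W 0 c3.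

Definition conservative (g : R) W : 'rV[R]_4 :=
  let h := height W in
  let u := (velocity W).1 in
  let v := (velocity W).2 in
  let p := pressure W in
  \row_(i < 4) [:: h; h * u; h * v; 2 / g * (p / h)]`_i.

Definition flux (g : R) U : 'M[R]_(4, 2) :=
  let h := U 0 c0 in
  let u := U 0 c1 / h in
  let v := U 0 c2 / h in
  let theta := U 0 c3 / h in
  \matrix_(i < 4, j < 2) nth 0 (nth [::]
    [:: [:: h * u; h * v];
        [:: h * u ^+ 2 + g / 2 * h ^+ 2 * theta; h * u * v];
        [:: h * u * v; h * v ^+ 2 + g / 2 * h ^+ 2 * theta];
        [:: h * theta * u; h * theta * v]] i) j.

Definition ex : R * R := (1, 0).
Definition ey : R * R := (0, 1).

Definition source (g : R) U (b : R * R -> R) x : 'rV[R]_4 :=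
  let htheta := U 0 c3 in
  \row_(i < 4)
    [:: 0; - g * htheta * 'D_ex b x; - g * htheta * 'D_ey b x; 0]`_i.

Definition normal_flux (g : R) n U : 'rV[R]_4 :=
  \row_(i < 4) (flux g U i 0 * n.1 + flux g U i 1 * n.2).

Definition dot2 (a n : R * R) : R := a.1 * n.1 + a.2 * n.2.

Definition dot4 (a a' : 'rV[R]_4) : R := \sum_(i < 4) a 0 i * a' 0 i.

Definition frobenius (A B : 'M[R]_(4, 2)) : R :=
  \sum_(i < 4) \sum_(j < 2) A i j * B i j.

Definition grad (phi : R * R -> 'rV[R]_4) x : 'M[R]_(4, 2) :=
  \matrix_(i < 4, j < 2)
    'D_([:: ex; ey]`_j) (fun y : R * R => phi y 0 i) x.

Record cell := Cell { xl : R; xr : R; yl : R; yr : R }.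

Definition open_cell (T : cell) : set (R * R) :=
  [set x | xl T < x.1 < xr T /\ yl T < x.2 < yr T].

Definition closed_cell (T : cell) : set (R * R) :=
  [set x | xl T <= x.1 <= xr T /\ yl T <= x.2 <= yr T].

Definition rectangular_mesh (Omega : set (R * R)) (N : nat)
    (K : 'I_N -> cell) : Prop :=
  [/\ forall i, xl (K i) < xr (K i) /\ yl (K i) < yr (K i),
      trivIset setT (fun i => open_cell (K i)),
      forall i, open_cell (K i) `<=` Omega &
      Omega `<=` \bigcup_i closed_cell (K i)].

Definition boundary (Omega : set (R * R)) : set (R * R) :=
  closure Omega `\` interior Omega.

Definition peval (P : mpoly 2 R) x : R :=
  meval (fun j : 'I_2 => [:: x.1; x.2]`_j) P.

(* [mmeasure mdeg] is [msize], i.e. one plus the total degree (0 for P = 0). *)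
Definition degree_le (k : nat) (P : mpoly 2 R) : Prop :=
  (mmeasure mdeg P <= k.+1)%N.

(* Discontinuous functions have no canonical value on the skeleton of the mesh,
   hence membership only concerns the open cells; values on cell boundaries are
   always taken as one-sided traces. *)
Definition Wh (N : nat) (K : 'I_N -> cell) (k : nat) (w : R * R -> R) : Prop :=
  forall i, exists2 P, degree_le k P &
    forall x, open_cell (K i) x -> w x = peval P x.

Definition Vh (N : nat) (K : 'I_N -> cell) (k : nat)
    (W : R * R -> 'rV[R]_4) : Prop :=
  forall j : 'I_4, Wh K k (fun x => W x 0 j).

(* Positivity on the closed cell of the polynomial that [w] is in the open
   cell. *)
Definition positive_on_closed_cells (N : nat) (K : 'I_N -> cell)
    (w : R * R -> R) : Prop :=
  forall i, exists2 P, (forall x, open_cell (K i) x -> w x = peval P x) &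
    forall x, closed_cell (K i) x -> 0 < peval P x.

Definition trace_int (W : R * R -> 'rV[R]_4) n x : 'rV[R]_4 :=
  \row_(j < 4) lim (W (x - eps *: n) 0 j @[eps --> 0^'+]).

(* [Wout] is the exterior state prescribed on the boundary of the domain. *)
Definition trace_ext (Omega : set (R * R)) (Wout W : R * R -> 'rV[R]_4)
    n x : 'rV[R]_4 :=
  if x \in boundary Omega then Wout x
  else \row_(j < 4) lim (W (x + eps *: n) 0 j @[eps --> 0^'+]).

(* The supremum over the open cells is the maximum over the closed cells of the
   traces from inside; ['J] acts on rows, so it is the transpose of the usual
   Jacobian matrix, with the same eigenvalues. These are real since the system
   is hyperbolic for h, theta > 0. *)
Definition max_wave_speed (g : R) (N : nat) (K : 'I_N -> cell)
    (V : R * R -> 'rV[R]_4) : R :=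
  sup [set s | exists i x n lambda,
    [/\ open_cell (K i) x, n \in [:: ex; - ex; ey; - ey],
        eigenvalue ('J (normal_flux g n) (conservative g (V x))) lambda &
        s = `|lambda| ]].

Definition delta (un_int un_ext : R) : R :=
  Num.max (- Num.min un_int 0 / Num.max `|un_int| 1)
          (Num.max un_ext 0 / Num.max `|un_ext| 1).

Definition modified_flux (g alpha : R) n (Vint Vext : 'rV[R]_4) : 'rV[R]_4 :=
  let Uint := conservative g Vint in
  let Uext := conservative g Vext in
  let d := delta (dot2 (velocity Vint) n) (dot2 (velocity Vext) n) in
  2^-1 *: (normal_flux g n Uint + normal_flux g n Uext
           - (alpha * d) *: (Uext - Uint)).

Definition cell_integral (T : cell) (f : R * R -> R) : R :=
  \int[(lebesgue_measure \x lebesgue_measure)%E]_(x in open_cell T) f x.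

(* Integral over the boundary of a cell of [f n x], where [n] is the outward
   unit normal. *)
Definition boundary_integral (T : cell) (f : R * R -> R * R -> R) : R :=
  \int[lebesgue_measure]_(y in `[yl T, yr T]) f ex (xr T, y)
  + \int[lebesgue_measure]_(y in `[yl T, yr T]) f (- ex) (xl T, y)
  + \int[lebesgue_measure]_(x in `[xl T, xr T]) f ey (x, yr T)
  + \int[lebesgue_measure]_(x in `[xl T, xr T]) f (- ey) (x, yl T).

Definition rhs_iso (g : R) (Omega : set (R * R)) (N : nat) (K : 'I_N -> cell)
    (Vout V : R * R -> 'rV[R]_4) (b : R * R -> R)
    (i : 'I_N) (phi : R * R -> 'rV[R]_4) : R :=
  let T := K i in
  let alpha := max_wave_speed g K V in
  cell_integral T (fun x => frobenius (flux g (conservative g (V x)))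
                                      (grad phi x))
  - boundary_integral T (fun n x =>
      dot4 (modified_flux g alpha n (trace_int V n x)
                                    (trace_ext Omega Vout V n x))
           (trace_int phi n x))
  + cell_integral T (fun x => dot4 (source g (conservative g (V x)) b x)
                                   (phi x)).

Definition isobaric (c : R) W : Prop :=
  velocity W = (0, 0) /\ pressure W = c.

End Ripa.

Arguments cell : clear implicits.

(* Main.v *)
(* On an isobaric state the flux of the momentum is [c] times the identity, and
   the velocities vanish, so the numerical viscosity is switched off by
   [delta 0 0 = 0] and the modified flux equals the exact one, [c n], whatever
   the jump of the height. The source vanishes because [b] is locally constant,
   and what remains is the divergence theorem for the polynomials [phi_2, phi_3]
   on a rectangle. The exterior state at a point of an edge is a trace from a
   cell, or prescribed, for all but finitely many points: a ray leaving
   transversally to the lines of the mesh stays in a single open cell for a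
   short time, since there are finitely many cells. *)

Require Import Defs.
From mathcomp Require Import all_boot all_order all_algebra.
From mathcomp Require Import all_classical all_reals all_analysis.
From mathcomp Require Import measurable_realfun ring.
From mathcomp Require Import -(notations) mpoly.
Import Order.TTheory GRing.Theory Num.Theory.
Import numFieldNormedType.Exports.
Local Open Scope classical_set_scope.
Local Open Scope ring_scope.

(** * Regularity and directional derivatives of polynomial functions of two variables *)

Section PolynomialFunctions.
Context {R : realType}.
Implicit Types (P : mpoly 2 R) (z : R * R).

(** Induction on the function instead of the formal polynomial: a monomial is a product of powers of
    the coordinates, so constants, coordinates, sums and products suffice. Continuity, measurability
    and differentiability all follow from these five cases. *)
Lemma peval_ind (S : (R * R -> R) -> Prop) :
  (forall c : R, S (fun=> c)) -> S fst -> S snd ->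
  (forall f g, S f -> S g -> S (fun z => f z + g z)) ->
  (forall f g, S f -> S g -> S (fun z => f z * g z)) ->
  forall P, S (peval P).
Proof.
move=> Sc S1 S2 SD SM P.
have SX (f : R * R -> R) n : S f -> S (fun z => f z ^+ n).
  move=> Sf; elim: n => [|n IHn]; first exact: Sc.
  by under eq_fun do rewrite exprS; exact: SM.
elim/mpolyind: P => [|a m P _ _ IHP].
  by rewrite /peval; under eq_fun do rewrite meval0; exact: Sc.
have -> : peval (a *: mpolyX R m + P) =
    fun z : R * R => a * (z.1 ^+ m 0 * z.2 ^+ m 1) + peval P z.
  apply/funext => z; rewrite /peval mevalD mevalZ mevalX.
  by rewrite big_ord_recl big_ord1; congr (_ * (_ * _ ^+ m _) + _); exact/val_inj.
apply: SD => //; apply: (SM (fun=> a)); first exact: Sc.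
by apply: SM; exact: SX.
Qed.

Lemma peval_continuous P : continuous (peval P : R * R -> R).
Proof.
apply: (peval_ind (fun f : R * R -> R => continuous f)) => [c|||f g fc gc|f g fc gc] z.
- exact: cvg_cst.
- exact: cvg_fst.
- exact: cvg_snd.
- exact: cvgD (fc z) (gc z).
- exact: cvgM (fc z) (gc z).
Qed.

Lemma peval_measurable P :
  measurable_fun setT (peval P : measurableTypeR R * measurableTypeR R -> R).
Proof.
apply: (peval_ind (fun f => measurable_fun setT (f : measurableTypeR R * measurableTypeR R -> R))).
- by move=> c; exact: measurable_cst.
- exact: measurable_fst.
- exact: measurable_snd.
- by move=> f g mf mg; exact: measurable_funD.
- by move=> f g mf mg; exact: measurable_funM.
Qed.

(** The same [P'] serves every base point [z] and every parameter [t], so the derivative along [v]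
    is itself a polynomial function, hence continuous and integrable. *)
Lemma peval_is_derive P (v : R * R) : exists P' : mpoly 2 R, forall z (t : R),
  is_derive t 1 (fun s : R => peval P (z + s *: v)) (peval P' (z + t *: v)).
Proof.
(* [peval_ind] speaks of functions, so the predicate also carries a polynomial [Q] representing the
   function; the product rule needs it to form its witness. *)
suff: exists Q, peval P = peval Q /\ exists Q' : mpoly 2 R, forall z (t : R),
  is_derive t 1 (fun s : R => peval P (z + s *: v)) (peval Q' (z + t *: v)).
  by case=> Q [_].
have daff (a b t : R) : is_derive t 1 (fun s : R => a + s * b) b.
  have := is_deriveD (is_derive_cst a t 1) (is_deriveM (is_derive_id t 1) (is_derive_cst b t 1)).
  by rewrite scaler0 !add0r /GRing.scale /= mulr1.
apply: (peval_ind (fun f => exists Q, f = peval Q /\ exists Q' : mpoly 2 R,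
  forall z (t : R), is_derive t 1 (fun s : R => f (z + s *: v)) (peval Q' (z + t *: v)))).
- move=> a; exists (mpolyC 2 a); split.
    by apply/funext => z; rewrite /peval mevalC.
  by exists 0 => z t; rewrite /peval meval0; exact: is_derive_cst.
- exists (mpolyX R (mnm1 0)); split.
    by apply/funext => z; rewrite /peval mevalXU.
  by exists (mpolyC 2 v.1) => z t; rewrite /peval mevalC; exact: daff.
- exists (mpolyX R (mnm1 1)); split.
    by apply/funext => z; rewrite /peval mevalXU.
  by exists (mpolyC 2 v.2) => z t; rewrite /peval mevalC; exact: daff.
- move=> _ _ [F [-> [F' dF]]] [G [-> [G' dG]]]; exists (F + G); split.
    by apply/funext => z; rewrite /peval mevalD.
  by exists (F' + G') => z t; rewrite /peval mevalD; exact: is_deriveD.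
- move=> _ _ [F [-> [F' dF]]] [G [-> [G' dG]]]; exists (F * G); split.
    by apply/funext => z; rewrite /peval mevalM.
  exists (F * G' + G * F') => z t; rewrite /peval mevalD !mevalM.
  exact: is_deriveM.
Qed.

(** The two difference quotients are equal for every increment, so the limits agree whether or not
    [f] is differentiable. *)
Lemma derive_line (f : R * R -> R) (z v : R * R) :
  'D_v f z = 'D_1 (fun t : R => f (z + t *: v)) 0.
Proof.
have dq (h : R) : h^-1 *: (f (h *: v + z) - f z) =
    h^-1 *: (f (z + (h *: 1 + 0 : R) *: v) - f (z + 0 *: v)).
  by rewrite scale0r !addr0 (_ : h *: (1 : R) = h) ?[z + _]addrC //; exact: mulr1.
by apply: (congr1 (fun F : R -> R^o => lim (F h @[h --> 0^']))); apply/funext.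
Qed.

Lemma derive_peval P (v : R * R) : exists P' : mpoly 2 R,
  'D_v (peval P) = peval P' /\
  forall z (t : R),
    is_derive t 1 (fun s : R => peval P (z + s *: v)) (peval P' (z + t *: v)).
Proof.
have [P' dP] := peval_is_derive P v; exists P'; split=> //.
apply/funext => z; rewrite derive_line.
by have [_ ->] := dP z 0; rewrite scale0r addr0.
Qed.

(** * Integration over cells and the divergence theorem on a rectangle *)

Lemma open_cellE (T : cell R) :
  open_cell T = `]xl T, xr T[ `*` `]yl T, yr T[.
Proof. by apply/seteqP; split => z; rewrite /open_cell /= !in_itv. Qed.

Lemma measurable_open_cell (T : cell R) :
  measurable (open_cell T : set (measurableTypeR R * measurableTypeR R)).
Proof. by rewrite open_cellE; apply: measurableX; exact: measurable_itv. Qed.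

(** The open cell has finite measure, and the polynomial is bounded on the compact closed rectangle
    that contains it. *)
Lemma peval_integrable P (T : cell R) :
  (lebesgue_measure \x lebesgue_measure)%E.-integrable (open_cell T) (EFin \o peval P).
Proof.
apply: measurable_bounded_integrable.
- exact: measurable_open_cell.
- rewrite open_cellE [ltLHS]product_measure1E; try exact: measurable_itv.
  have fin (a b : R) : (lebesgue_measure `]a, b[ < +oo)%E.
    by rewrite lebesgue_measure_itv /=; case: ifPn => _; rewrite -?EFinB ltry.
  apply: lte_mul_pinfty; [exact: measure_ge0 | | exact: fin].
  by rewrite ge0_fin_numE; [exact: fin | exact: measure_ge0].
- exact: measurable_funS (peval_measurable P).
- have cK : compact (`[xl T, xr T] `*` `[yl T, yr T] : set (R * R)).
    by apply: compact_setX; exact: segment_compact.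
  have := compact_bounded (continuous_compact (continuous_subspaceT (@peval_continuous P)) cK).
  move=> [M [Mr bM]]; exists M; split => // N MN z; rewrite open_cellE => -[zx zy].
  by apply: (bM N MN); exists z => //; split; exact: subset_itv_oo_cc.
Qed.

(** The fundamental theorem of calculus, stated on an open interval because the slices of an open
    cell are open. *)
Lemma integral_is_derive (f F : R -> R) (a b : R) : a < b ->
  (forall x : R, is_derive x 1 F (f x)) -> continuous f ->
  (\int[lebesgue_measure]_(x in `]a, b[) (f x)%:E = (F b - F a)%:E)%E.
Proof.
move=> ab dF cf.
have cF : continuous F.
  move=> x; apply: differentiable_continuous; apply/derivable1_diffP.
  by have [] := dF x.
rewrite -(@integral_itv_bndoo _ a b _ true false); last first.
  by apply/measurable_EFinP; apply: measurable_funTS; exact: continuous_measurable_fun.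
rewrite (@continuous_FTC2 _ f F) //.
- exact: continuous_subspaceT.
- split=> [x _||].
  + by have [] := dF x.
  + exact: cvg_at_right_filter (cF a).
  + exact: cvg_at_left_filter (cF b).
- by move=> x _; rewrite derive1E; have [_] := dF x.
Qed.

Lemma peval_continuous_fst P (y : R) : continuous (fun x : R => peval P (x, y)).
Proof.
move=> x; apply: (@continuous_comp _ _ _ (fun t : R => (t, y)) (peval P)).
  by apply: (@cvg_pair _ _ _ _ (nbhs (x : R)) (nbhs y)); [exact: cvg_id | exact: cvg_cst].
exact: peval_continuous.
Qed.

Lemma peval_continuous_snd P (x : R) : continuous (fun y : R => peval P (x, y)).
Proof.
move=> y; apply: (@continuous_comp _ _ _ (fun t : R => (x, t)) (peval P)).
  by apply: (@cvg_pair _ _ _ _ (nbhs x) (nbhs (y : R))); [exact: cvg_cst | exact: cvg_id].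
exact: peval_continuous.
Qed.

(** Fubini with the integral in [x] inside, which the fundamental theorem of calculus evaluates on
    each horizontal slice. *)
Lemma cell_integral_derive_ex P (T : cell R) : xl T < xr T ->
  cell_integral T ('D_ex (peval P)) =
  \int[lebesgue_measure]_(y in `[yl T, yr T])
     (peval P (xr T, y) - peval P (xl T, y)).
Proof.
move=> ltx; have [P' [-> dP]] := derive_peval P ex.
have dP' (y x : R) : is_derive x 1 (fun s => peval P (s, y)) (peval P' (x, y)).
  (* Writing the slice as a line with direction [ex] turns the derivative along [ex] into an
     ordinary one. *)
  have E (s : R) : (s, y) = (0, y) + s *: ex.
    apply/pair_equal_spec; split; first by rewrite /= add0r; exact/esym/mulr1.
    by rewrite /= scaler0 addr0.
  by rewrite E; under eq_fun do rewrite E; exact: dP.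
rewrite /cell_integral /Rintegral; congr fine.
(* Fubini is applied on the whole plane, to the integrand extended by zero outside the cell. *)
rewrite integral_mkcond -integral21_prod_meas1; last first.
  exact: (iffLR (integrable_mkcond _ (measurable_open_cell T)) (peval_integrable P' T)).
rewrite [RHS](@integral_itv_bndoo _ (yl T) (yr T) _ true false); last first.
  apply/measurable_EFinP; apply: measurable_funTS; apply: measurable_funB;
    apply: continuous_measurable_fun; exact: peval_continuous_snd.
rewrite [RHS]integral_mkcond; apply: eq_integral => y _.
(* The slice at height [y] is the full open interval if [y] lies in the open side, and empty
   otherwise. *)
rewrite /fubini_G patchE open_cellE; case: ifPn => [|ynT].
  rewrite inE => yT.
  rewrite -(integral_is_derive _ _ _ _ ltx (dP' y) (peval_continuous_fst P' y)).
  rewrite [RHS]integral_mkcond; apply: eq_integral => x _.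
  by rewrite !patchE; congr (if _ then _ else _); rewrite in_setX (mem_set yT) andbT.
by apply: integral0_eq => x _; rewrite patchE in_setX (negbTE ynT) andbF.
Qed.

Lemma cell_integral_derive_ey P (T : cell R) : yl T < yr T ->
  cell_integral T ('D_ey (peval P)) =
  \int[lebesgue_measure]_(x in `[xl T, xr T])
     (peval P (x, yr T) - peval P (x, yl T)).
Proof.
move=> lty; have [P' [-> dP]] := derive_peval P ey.
have dP' (x y : R) : is_derive y 1 (fun s => peval P (x, s)) (peval P' (x, y)).
  have E (s : R) : (x, s) = (x, 0) + s *: ey.
    apply/pair_equal_spec; split; first by rewrite /= scaler0 addr0.
    by rewrite /= add0r; exact/esym/mulr1.
  by rewrite E; under eq_fun do rewrite E; exact: dP.
rewrite /cell_integral /Rintegral; congr fine.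
rewrite integral_mkcond -integral12_prod_meas1; last first.
  exact: (iffLR (integrable_mkcond _ (measurable_open_cell T)) (peval_integrable P' T)).
rewrite [RHS](@integral_itv_bndoo _ (xl T) (xr T) _ true false); last first.
  apply/measurable_EFinP; apply: measurable_funTS; apply: measurable_funB;
    apply: continuous_measurable_fun; exact: peval_continuous_fst.
rewrite [RHS]integral_mkcond; apply: eq_integral => x _.
rewrite /fubini_F patchE open_cellE; case: ifPn => [|xnT].
  rewrite inE => xT.
  rewrite -(integral_is_derive _ _ _ _ lty (dP' x) (peval_continuous_snd P' x)).
  rewrite [RHS]integral_mkcond; apply: eq_integral => y _.
  by rewrite !patchE; congr (if _ then _ else _); rewrite in_setX (mem_set xT).
by apply: integral0_eq => y _; rewrite patchE in_setX (negbTE xnT).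
Qed.

Lemma derive_peval_integrable P (v : R * R) (T : cell R) :
  (lebesgue_measure \x lebesgue_measure)%E.-integrable (open_cell T)
    (EFin \o 'D_v (peval P)).
Proof.
by have [P' [-> _]] := derive_peval P v; exact: peval_integrable.
Qed.

Lemma continuous_itv_integrable (f : R -> R) (a b : R) : continuous f ->
  lebesgue_measure.-integrable `[a, b] (EFin \o f).
Proof.
move=> cf; apply: continuous_compact_integrable; first exact: segment_compact.
exact: continuous_subspaceT.
Qed.

Lemma cell_integral_divergence P Q (T : cell R) : xl T < xr T -> yl T < yr T ->
  cell_integral T (fun z => 'D_ex (peval P) z + 'D_ey (peval Q) z) =
  \int[lebesgue_measure]_(y in `[yl T, yr T]) peval P (xr T, y)
  - \int[lebesgue_measure]_(y in `[yl T, yr T]) peval P (xl T, y)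
  + \int[lebesgue_measure]_(x in `[xl T, xr T]) peval Q (x, yr T)
  - \int[lebesgue_measure]_(x in `[xl T, xr T]) peval Q (x, yl T).
Proof.
move=> ltx lty; rewrite {1}/cell_integral.
rewrite (RintegralD (measurable_open_cell T) (derive_peval_integrable P ex T)
  (derive_peval_integrable Q ey T)).
have := cell_integral_derive_ex P _ ltx; rewrite {1}/cell_integral => ->.
have := cell_integral_derive_ey Q _ lty; rewrite {1}/cell_integral => ->.
have segx := measurable_itv `[xl T, xr T].
have segy := measurable_itv `[yl T, yr T].
rewrite !RintegralB //; try (apply: continuous_itv_integrable;
  by [exact: peval_continuous_fst | exact: peval_continuous_snd]).
by rewrite addrA.
Qed.

(** Lets the numerical flux, known only off finitely many points of an edge, be replaced by a
    polynomial under the integral. The points of [F] are removed from [D] one by one. *)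
Lemma Rintegral_off_finite (F : seq R) (f h : R -> R) (D : set R) :
  measurable (D : set (measurableTypeR R)) ->
  measurable_fun (D : set (measurableTypeR R)) (h : measurableTypeR R -> R) ->
  (forall x, D x -> x \notin F -> f x = h x) ->
  \int[lebesgue_measure]_(x in D) f x = \int[lebesgue_measure]_(x in D) h x.
Proof.
move=> mD mh fh; rewrite /Rintegral; congr fine.
(* Measurability of [f] is proved in the same induction, since putting a point back into the domain
   of integration requires it. *)
suff [] : measurable_fun (D : set (measurableTypeR R)) (f : measurableTypeR R -> R) /\
  (\int[lebesgue_measure]_(x in D) (f x)%:E =
   \int[lebesgue_measure]_(x in D) (h x)%:E)%E by [].
elim: F D mD mh fh => [|r F IHF] D mD mh fh.
  split; first by apply: eq_measurable_fun mh => x /set_mem Dx; rewrite fh.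
  by apply: eq_integral => x /set_mem Dx; rewrite fh.
have mr : measurable ([set r] : set (measurableTypeR R)) by exact: measurable_set1.
have mDr : measurable (D `\ r : set (measurableTypeR R)) by exact: measurableD.
have mhr : measurable_fun (D `\ r : set (measurableTypeR R)) (h : measurableTypeR R -> R).
  by apply: measurable_funS mh => // x [].
have [|mf fhE] := IHF (D `\ r) mDr mhr.
  by move=> x [Dx /eqP xr] xF; apply: fh => //; rewrite inE negb_or xr.
split.
  have [Dr|Dr] := pselect (D r); last by rewrite -(not_setD1 Dr).
  rewrite -(setD1K Dr); apply/measurable_funU => //; split=> //.
  exact: measurable_fun_set1.
rewrite -(@integral_setD1 _ _ r) //; last exact/measurable_EFinP.
by rewrite fhE integral_setD1 //; exact/measurable_EFinP.
Qed.

End PolynomialFunctions.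

(** * Exact and numerical fluxes of isobaric states *)

Section IsobaricFlux.
Context {R : realType}.
Implicit Types (W : 'rV[R]_4) (g c h : R) (n x v : R * R).

Lemma flux_isobaric g c W i j : 0 < g -> 0 < height W -> isobaric c W ->
  flux g (conservative g W) i j = nth 0 (nth [::]
    [:: [:: 0; 0]; [:: c; 0]; [:: 0; c]; [:: 0; 0]] i) j.
Proof.
rewrite /isobaric /flux /conservative => /lt0r_neq0 g0 /lt0r_neq0 h0 [-> ->].
rewrite !mxE /=.
(* The conversion to conservative variables is undone: the pressure recomputed from [h] and
   [h * theta] is the original [c]. *)
have E : g / 2 * height W ^+ 2 * (2 / g * (c / height W) / height W) = c.
  by field; rewrite g0 h0.
by rewrite E !mulr0 !mul0r !mulr0 expr0n mulr0 add0r.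
Qed.

Lemma normal_flux_isobaric g c n W : 0 < g -> 0 < height W -> isobaric c W ->
  normal_flux g n (conservative g W) = \row_(i < 4) [:: 0; c * n.1; c * n.2; 0]`_i.
Proof.
move=> g0 h0 isoW; apply/rowP => i; rewrite [LHS]mxE [RHS]mxE !(flux_isobaric _ c) //=.
by case: i => [[|[|[|[|]]]]] //= _; rewrite !(mul0r, addr0, add0r).
Qed.

Lemma delta0 : delta 0 0 = 0 :> R.
Proof. by rewrite /delta minxx maxxx oppr0 !mul0r maxxx. Qed.

Lemma modified_flux_isobaric g alpha c n Vint Vext : 0 < g ->
  0 < height Vint -> isobaric c Vint -> 0 < height Vext -> isobaric c Vext ->
  modified_flux g alpha n Vint Vext =
  \row_(i < 4) [:: 0; c * n.1; c * n.2; 0]`_i.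
Proof.
move=> g0 hi isoi he isoe; rewrite /modified_flux.
rewrite !(normal_flux_isobaric _ c) //.
rewrite /isobaric in isoi isoe; rewrite isoi.1 isoe.1 /dot2 /= !mul0r addr0.
rewrite delta0 mulr0 scale0r subr0; move: (\row_i _) => w.
by apply/rowP => i; rewrite !mxE; field.
Qed.

(** The isobaric flux has only momentum components, so only these two components of the test
    function are seen. *)
Lemma dot4_momentum (a b : R) W :
  dot4 (\row_(i < 4) [:: 0; a; b; 0]`_i) W = a * W 0 c1 + b * W 0 c2.
Proof.
rewrite /dot4 !big_ord_recl big_ord0 !mxE /= !mul0r add0r !addr0.
by congr (_ * W _ _ + _ * W _ _); exact/val_inj.
Qed.

End IsobaricFlux.

(** * One-sided limits along rays, and the position of a ray relative to the mesh *)

Section Traces.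
Context {R : realType}.
Implicit Types (T : cell R) (n x v : R * R).

Lemma line_cvg x v : (x + eps *: v) @[eps --> (0 : R)^'+] --> x.
Proof.
rewrite -[X in _ --> X]addr0 -(scale0r v).
apply: cvgD; first exact: cvg_cst.
by apply: cvgZl; apply: cvg_at_right_filter; exact: cvg_id.
Qed.

(** For small [eps > 0] the sign is that of [a], or that of [b] when [a = 0]. *)
Lemma affine_sign (a b : R) : (a != 0) || (b != 0) ->
  (\forall eps \near 0^'+, 0 < a + eps * b) \/
  (\forall eps \near 0^'+, a + eps * b < 0).
Proof.
have cvga : a + eps * b @[eps --> (0:R)^'+] --> a.
  have : (a + eps * b) @[eps --> (0 : R)^'+] --> a + 0 * b.
    apply: cvgD; first exact: cvg_cst.
    by apply: cvgMl; apply: cvg_at_right_filter; exact: cvg_id.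
  by rewrite mul0r addr0.
case: (ltgtP a 0) => [a0|a0|->] /=.
- by right; exact: (cvgr_lt _ cvga).
- by left; exact: (cvgr_gt _ cvga).
move=> b0.
case: (ltgtP b 0) b0 => // b0 _; [right|left]; near=> eps; rewrite add0r.
- by rewrite nmulr_llt0.
- by rewrite mulr_gt0.
Unshelve. all: by end_near. Qed.

Lemma closed_cell_closed T : closed (closed_cell T).
Proof.
have -> : closed_cell T = fst @^-1` `[xl T, xr T] `&` snd @^-1` `[yl T, yr T].
  by apply/seteqP; split => z; rewrite /closed_cell /= !in_itv.
apply: closedI; apply: closed_comp => [z _|];
  by [exact: cvg_fst | exact: cvg_snd | exact: itv_closed].
Qed.

Lemma open_cell_open T : open (open_cell T).
Proof.
have -> : open_cell T = fst @^-1` `]xl T, xr T[ `&` snd @^-1` `]yl T, yr T[.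
  by apply/seteqP; split => z; rewrite /open_cell /= !in_itv.
apply: openI; apply: open_comp => [z _|];
  by [exact: cvg_fst | exact: cvg_snd | exact: itv_open].
Qed.

Lemma open_closed_cell T : open_cell T `<=` closed_cell T.
Proof. by move=> z [/andP[/ltW ? /ltW ?] /andP[/ltW ? /ltW ?]]; split; apply/andP. Qed.

Lemma line_closed (A : set (R * R)) x v : closed A ->
  (\forall eps \near 0^'+, A (x + eps *: v)) -> A x.
Proof. by move=> cA Ax; apply: (closed_cvg A cA Ax); exact: line_cvg. Qed.

(** The one-sided limit sees [W] only inside the open cell, where it equals [f]; the point [x]
    itself may lie on the boundary. *)
Lemma trace_polynomial T (W : R * R -> 'rV[R]_4) j (f : R * R -> R) x v :
  {for x, continuous f} -> (forall z, open_cell T z -> W z 0 j = f z) ->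
  (\forall eps \near 0^'+, open_cell T (x + eps *: v)) ->
  lim (W (x + eps *: v) 0 j @[eps --> 0^'+]) = f x.
Proof.
move=> cf WE Tx; apply: cvg_lim => //.
have := cvg_comp _ _ (line_cvg x v) cf; apply: cvg_trans; apply: near_eq_cvg.
by near=> eps; rewrite /= WE //; near: eps.
Unshelve. all: by end_near. Qed.

(* The ray [x + eps *: v] does not run along a line supporting a side of [T]. *)
Definition transverse T x v :=
  [/\ (v.1 != 0) || (x.1 != xl T), (v.1 != 0) || (x.1 != xr T),
      (v.2 != 0) || (x.2 != yl T) & (v.2 != 0) || (x.2 != yr T)].

(** Along the ray each of the four inequalities defining the cell is eventually strict in one
    direction: either all four hold strictly, or one fails even in its weak form. *)
Lemma transverse_in_or_out T x v : transverse T x v ->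
  (\forall eps \near 0^'+, open_cell T (x + eps *: v)) \/
  (\forall eps \near 0^'+, ~ closed_cell T (x + eps *: v)).
Proof.
have side (a b d : R) : (b != 0) || (a != d) ->
    (\forall eps \near 0^'+, d < a + eps *: b) \/
    (\forall eps \near 0^'+, a + eps *: b < d).
  rewrite orbC -subr_eq0 => /affine_sign[] S; [left|right];
    by apply: filterS S => eps; rewrite addrAC ?subr_gt0 ?subr_lt0.
move=> [/side[S1|S] s2 s3 s4]; last first.
  by right; apply: filterS S => eps /lt_geF S [/andP[]]; rewrite /= S.
move: s2 => /side[S|S2].
  by right; apply: filterS S => eps /lt_geF S [/andP[_]]; rewrite /= S.
move: s3 => /side[S3|S]; last first.
  by right; apply: filterS S => eps /lt_geF S [_ /andP[]]; rewrite /= S.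
move: s4 => /side[S|S4].
  by right; apply: filterS S => eps /lt_geF S [_ /andP[_]]; rewrite /= S.
by left; near=> eps; split; apply/andP; split; near: eps.
Unshelve. all: by end_near. Qed.

(** Otherwise the ray would eventually avoid all closed cells at once, by finiteness of the mesh,
    while still lying in the open set [Omega] that they cover. *)
Lemma transverse_enters (Omega : set (R * R)) N (K : 'I_N -> cell R) x v :
  open Omega -> rectangular_mesh Omega K -> Omega x ->
  (forall j, transverse (K j) x v) ->
  exists j, \forall eps \near 0^'+, open_cell (K j) (x + eps *: v).
Proof.
move=> oO [_ _ _ cover] Ox tr; apply: contrapT => /forallNP noj.
have Onear : \forall eps \near 0^'+, Omega (x + eps *: v).
  exact: (line_cvg x v _ (open_nbhs_nbhs (conj oO Ox))).
have out : \forall eps \near 0^'+, forall j, ~ closed_cell (K j) (x + eps *: v).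
  apply: filter_forall => j.
  by have [/noj|] := transverse_in_or_out _ _ _ (tr j).
have [eps [/cover[j _ xj] /(_ j)]] := @filter_ex _ _ _ _ (filterI Onear out).
exact.
Qed.

End Traces.

(** * Traces of an isobaric discrete state and the flux integrand on an edge *)

Section Edges.
Context {R : realType} (g : R) (g_gt0 : 0 < g)
  (Omega : set (R * R)) (Omega_open : open Omega)
  (N : nat) (K : 'I_N -> cell R) (meshK : rectangular_mesh Omega K)
  (V Vout : R * R -> 'rV[R]_4) (c : R)
  (h_gt0 : positive_on_closed_cells K (fun x => height (V x)))
  (V_isobaric : forall i x, open_cell (K i) x -> isobaric c (V x))
  (Vout_isobaric : forall x, boundary Omega x ->
     0 < height (Vout x) /\ isobaric c (Vout x)).

(** Velocity and pressure are constant in the cell, so their limits are too. The height tends to its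
    polynomial at [x], which is positive there because [x], a limit of points of the cell, lies in
    the closed cell. *)
Lemma trace_isobaric i x v :
  (\forall eps \near 0^'+, open_cell (K i) (x + eps *: v)) ->
  let W := \row_(j < 4) lim (V (x + eps *: v) 0 j @[eps --> 0^'+]) in
  0 < height W /\ isobaric c W.
Proof.
move=> xi W.
have Wj j (f : R * R -> R) : {for x, continuous f} ->
    (forall z, open_cell (K i) z -> V z 0 j = f z) -> W 0 j = f x.
  by move=> cf Vf; rewrite mxE; exact: trace_polynomial cf Vf xi.
have [P hP Ppos] := h_gt0 i.
have isoV z (zi : open_cell (K i) z) := V_isobaric _ _ zi.
split.
  rewrite /height (Wj c0 (peval P)) //; last exact: peval_continuous.
  apply: Ppos; apply: line_closed _ _ _ (closed_cell_closed (K i)) _.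
  by apply: filterS xi => eps; exact: open_closed_cell.
split.
  rewrite /velocity (Wj c1 (cst 0)) ?(Wj c2 (cst 0)) //;
    try exact: cvg_cst; by move=> z /isoV[[]].
rewrite /pressure (Wj c3 (cst c)) //; first exact: cvg_cst.
by move=> z /isoV[].
Qed.

Lemma edge_integrand i (phi : R * R -> 'rV[R]_4) (Q : 'I_4 -> mpoly 2 R)
    (n x : R * R) (alpha : R) :
  (forall j z, open_cell (K i) z -> phi z 0 j = peval (Q j) z) ->
  (\forall eps \near 0^'+, open_cell (K i) (x + eps *: - n)) ->
  (forall j, transverse (K j) x n) ->
  dot4 (modified_flux g alpha n (trace_int V n x) (trace_ext Omega Vout V n x))
       (trace_int phi n x) =
  c * (n.1 * peval (Q c1) x + n.2 * peval (Q c2) x).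
Proof.
move=> phiQ xi tr.
have intE (W : R * R -> 'rV[R]_4) :
    trace_int W n x = \row_(j < 4) lim (W (x + eps *: - n) 0 j @[eps --> 0^'+]).
  apply/rowP => j; rewrite !mxE.
  suff -> : (fun eps : R => W (x + eps *: - n) 0 j) =
            fun eps => W (x - eps *: n) 0 j by [].
  by apply/funext => eps; rewrite scalerN.
have phiE j : trace_int phi n x 0 j = peval (Q j) x.
  rewrite intE mxE; apply: trace_polynomial (phiQ j) xi.
  exact: peval_continuous.
have [hint isoint] := trace_isobaric _ _ _ xi.
have [hext isoext] : 0 < height (trace_ext Omega Vout V n x) /\
    isobaric c (trace_ext Omega Vout V n x).
  rewrite /trace_ext; case: ifPn => [/set_mem/Vout_isobaric //|].
  move=> /negP xb.
  (* The inward ray lies in [Omega], so [x] is in its closure; off the boundary only the interior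
     remains, and the outward ray then enters some cell. *)
  have xcl : closure Omega x.
    apply: line_closed _ _ _ (@closed_closure _ Omega) _; apply: filterS xi => eps.
    have [_ _ KO _] := meshK; move=> /KO; exact: subset_closure.
  have Ox : Omega x.
    apply: interior_subset; apply: contrapT => xint; apply: xb.
    by rewrite inE; split.
  have [j xj] := transverse_enters _ _ _ _ _ Omega_open meshK Ox tr.
  exact: trace_isobaric xj.
rewrite intE (modified_flux_isobaric _ _ c) // dot4_momentum !phiE; ring.
Qed.

(** A horizontal ray can only run along horizontal sides, and these have finitely many ordinates. *)
Lemma transverse_horizontal (x : R * R) (v : R) : v != 0 ->
  x.2 \notin [seq yl (K j) | j <- enum 'I_N] ++ [seq yr (K j) | j <- enum 'I_N] ->
  forall j, transverse (K j) x (v, 0).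
Proof.
rewrite mem_cat negb_or /transverse /= => -> /andP[xl xr] j; rewrite eqxx /=.
by split=> //; [apply: contraNneq xl | apply: contraNneq xr] => ->;
  apply/mapP; exists j; rewrite ?mem_enum.
Qed.

Lemma transverse_vertical (x : R * R) (v : R) : v != 0 ->
  x.1 \notin [seq xl (K j) | j <- enum 'I_N] ++ [seq xr (K j) | j <- enum 'I_N] ->
  forall j, transverse (K j) x (0, v).
Proof.
rewrite mem_cat negb_or /transverse /= => -> /andP[xl xr] j; rewrite eqxx /=.
by split=> //; [apply: contraNneq xl | apply: contraNneq xr] => ->;
  apply/mapP; exists j; rewrite ?mem_enum.
Qed.

(** Here [e] is the outward normal of the interval at its endpoint [d], so both opposite edges of a
    cell are treated at once. *)
Lemma inward_itv (a b e d : R) : a < b -> e = 1 /\ d = b \/ e = -1 /\ d = a ->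
  \forall eps \near (0 : R)^'+, a < d + eps *: - e < b.
Proof.
move=> ab [] [-> ->]; near=> eps.
- rewrite scalerN [eps *: 1]mulr1 gtrBl ltrBrDr -ltrBrDl; apply/andP; split => //.
  by near: eps; apply: nbhs_right_lt; rewrite subr_gt0.
- rewrite opprK [eps *: 1]mulr1 ltrDl -ltrBrDl; apply/andP; split => //.
  by near: eps; apply: nbhs_right_lt; rewrite subr_gt0.
Unshelve. all: by end_near. Qed.

(** * Boundary and volume integrals of the flux on one cell *)

Section Cell.
Context (i : 'I_N) (phi : R * R -> 'rV[R]_4) (Q : 'I_4 -> mpoly 2 R) (alpha : R)
  (phiQ : forall j z, open_cell (K i) z -> phi z 0 j = peval (Q j) z).

Let T := K i.

Let edge_flux n x :=
  dot4 (modified_flux g alpha n (trace_int V n x) (trace_ext Omega Vout V n x))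
       (trace_int phi n x).

Lemma vertical_edge_integral (e d : R) :
  e = 1 /\ d = xr T \/ e = -1 /\ d = xl T ->
  \int[lebesgue_measure]_(y in `[yl T, yr T]) edge_flux (e, 0) (d, y) =
  c * e * \int[lebesgue_measure]_(y in `[yl T, yr T]) peval (Q c1) (d, y).
Proof.
have [/(_ i)[ltx lty] _ _ _] := meshK; move=> ed.
have e0 : e != 0 by case: ed => -[-> _]; rewrite ?oppr_eq0 oner_eq0.
have seg := measurable_itv `[yl T, yr T].
rewrite -RintegralZl //; last by apply: continuous_itv_integrable; exact: peval_continuous_snd.
(* The points excluded by [F] include the corners of the cell, where traces
   along the edge normal are junk. *)
pose F := [seq yl (K j) | j <- enum 'I_N] ++ [seq yr (K j) | j <- enum 'I_N].
apply: (Rintegral_off_finite F) => //.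
  apply: measurable_funM; first exact: measurable_cst.
  apply: measurable_funTS; apply: continuous_measurable_fun.
  exact: peval_continuous_snd.
move=> y; rewrite /= in_itv /= => /andP[yl_y y_yr] yF.
have tr := transverse_horizontal (d, y) _ e0 yF.
rewrite /edge_flux (edge_integrand i _ Q) //=; first by ring.
(* Transversality to the cell [K i] itself makes the bounds on [y] strict, so the inward ray starts
   away from the corners. *)
have [_ _ ny1 ny2] := tr i; rewrite /= eqxx /= in ny1 ny2.
have ylt : yl T < y by rewrite lt_neqAle eq_sym ny1.
have ygt : y < yr T by rewrite lt_neqAle ny2.
apply: filterS (inward_itv _ _ _ _ ltx ed) => eps dx.
by split; rewrite //= oppr0 scaler0 addr0 ylt.
Qed.

Lemma horizontal_edge_integral (e d : R) :
  e = 1 /\ d = yr T \/ e = -1 /\ d = yl T ->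
  \int[lebesgue_measure]_(x in `[xl T, xr T]) edge_flux (0, e) (x, d) =
  c * e * \int[lebesgue_measure]_(x in `[xl T, xr T]) peval (Q c2) (x, d).
Proof.
have [/(_ i)[ltx lty] _ _ _] := meshK; move=> ed.
have e0 : e != 0 by case: ed => -[-> _]; rewrite ?oppr_eq0 oner_eq0.
have seg := measurable_itv `[xl T, xr T].
rewrite -RintegralZl //; last by apply: continuous_itv_integrable; exact: peval_continuous_fst.
pose F := [seq xl (K j) | j <- enum 'I_N] ++ [seq xr (K j) | j <- enum 'I_N].
apply: (Rintegral_off_finite F) => //.
  apply: measurable_funM; first exact: measurable_cst.
  apply: measurable_funTS; apply: continuous_measurable_fun.
  exact: peval_continuous_fst.
move=> x; rewrite /= in_itv /= => /andP[xl_x x_xr] xF.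
have tr := transverse_vertical (x, d) _ e0 xF.
rewrite /edge_flux (edge_integrand i _ Q) //=; first by ring.
have [nx1 nx2 _ _] := tr i; rewrite /= eqxx /= in nx1 nx2.
have xlt : xl T < x by rewrite lt_neqAle eq_sym nx1.
have xgt : x < xr T by rewrite lt_neqAle nx2.
apply: filterS (inward_itv _ _ _ _ lty ed) => eps dx.
by split; rewrite //= oppr0 scaler0 addr0 xlt.
Qed.

(** The signs [e] of the outward normals are exactly those of the divergence theorem on the
    rectangle. *)
Lemma boundary_integral_isobaric :
  boundary_integral T edge_flux =
  c * cell_integral T (fun z => 'D_ex (peval (Q c1)) z + 'D_ey (peval (Q c2)) z).
Proof.
have [/(_ i)[ltx lty] _ _ _] := meshK.
rewrite /boundary_integral cell_integral_divergence //.
have -> : - ex = (-1, 0) :> R * R by rewrite /ex -[in RHS]oppr0.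
have -> : - ey = (0, -1) :> R * R by rewrite /ey -[in RHS]oppr0.
rewrite !vertical_edge_integral ?horizontal_edge_integral; try by [left|right].
by ring.
Qed.

(** The momentum block of the flux is [c] times the identity, so its Frobenius product with the
    gradient is [c] times the divergence of the momentum components. *)
Lemma cell_integral_flux_isobaric :
  cell_integral T (fun x => frobenius (flux g (conservative g (V x))) (grad phi x)) =
  c * cell_integral T (fun z => 'D_ex (peval (Q c1)) z + 'D_ey (peval (Q c2)) z).
Proof.
have divI := integrableD (measurable_open_cell T)
  (derive_peval_integrable (Q c1) ex T) (derive_peval_integrable (Q c2) ey T).
rewrite /cell_integral -(RintegralZl _ (measurable_open_cell T) divI).
apply: eq_Rintegral => x /set_mem xT.
have isoV : isobaric c (V x) by exact: V_isobaric xT.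
have hx : 0 < height (V x).
  have [P hP Ppos] := h_gt0 i.
  by rewrite hP //; apply: Ppos; exact: open_closed_cell.
(* Derivatives are local, and the open cell is a neighbourhood of [x] on which [phi] is
   polynomial. *)
have dphi (v : R * R) j : 'D_v (fun y : R * R => phi y 0 j) x = 'D_v (peval (Q j)) x.
  apply: near_eq_derive; have := open_nbhs_nbhs (conj (open_cell_open T) xT).
  by apply: filterS => z; exact: phiQ.
(* [D] is generalized below to keep simplification from unfolding derivatives. *)
pose D (v : R * R) (j : 'I_4) := 'D_v (peval (Q j)) x.
have gradE m j : grad phi x m j = D ([:: ex; ey]`_j) m by rewrite mxE dphi.
rewrite -[RHS]/(c * (D ex c1 + D ey c2)).
rewrite /frobenius !big_ord_recl !big_ord0 !gradE.
rewrite !(flux_isobaric _ c) //.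
move: D {gradE} => D; rewrite /= !mul0r !addr0 !add0r mulrDr.
by congr (_ * D _ _ + _ * D _ _); exact/val_inj.
Qed.

End Cell.
End Edges.

(** * Vanishing of the source term, and assembly of the three integrals *)

Lemma source_eq0 {R : realType} (g b0 : R) (U : 'rV[R]_4) (Omega : set (R * R))
    (b : R * R -> R) x :
  open Omega -> Omega x -> (forall z, Omega z -> b z = b0) -> source g U b x = 0.
Proof.
move=> oO Ox bE.
have db (v : R * R) : 'D_v b x = 0.
  rewrite -(derive_cst b0 x v); apply: near_eq_derive.
  by have := open_nbhs_nbhs (conj oO Ox); apply: filterS => z; exact: bE.
by apply/rowP; case=> [[|[|[|[|]]]]] // ?; rewrite !mxE /= ?db ?mulr0.
Qed.

Theorem theorem3p2 (R : realType) (g : R) (g_gt0 : 0 < g)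
    (Omega : set (R * R)) (Omega_open : open Omega)
    (N : nat) (K : 'I_N -> cell R) (meshK : rectangular_mesh Omega K)
    (k : nat) (V Vout : R * R -> 'rV[R]_4) (b : R * R -> R) (b0 c : R)
    (V_dg : Vh K k V)
    (h_gt0 : positive_on_closed_cells K (fun x => height (V x)))
    (b_const : forall x, Omega x -> b x = b0)
    (V_isobaric : forall i x, open_cell (K i) x -> isobaric c (V x))
    (Vout_isobaric : forall x, boundary Omega x ->
       0 < height (Vout x) /\ isobaric c (Vout x)) :
  forall (i : 'I_N) (phi : R * R -> 'rV[R]_4), Vh K k phi ->
    rhs_iso g Omega K Vout V b i phi = 0.
Proof.
move=> i phi phi_dg.
have /choice[Q phiQ] j : exists Q : mpoly 2 R,
    forall x, open_cell (K i) x -> phi x 0 j = peval Q x.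
  by have [Q _ phiQ] := phi_dg j i; exists Q.
rewrite /rhs_iso /= (cell_integral_flux_isobaric _ _ _ _ _ c _ _ _ _ Q) //.
rewrite (boundary_integral_isobaric g g_gt0 Omega Omega_open N K meshK V Vout c
  h_gt0 V_isobaric Vout_isobaric i phi Q) //.
(* Volume and boundary terms are now the same multiple of the same divergence integral and cancel,
   leaving the source. *)
rewrite subrr add0r /cell_integral /Rintegral integral0_eq // => x xT.
rewrite (source_eq0 _ b0 _ Omega) //; last by have [_ _ KO _] := meshK; exact: KO xT.
by rewrite /dot4 big1 // => j _; rewrite mxE mul0r.
Qed.
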